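(* Let $p$ be a prime and $n\in\mathbb N$. There are group isomorphisms $$\mathcal F_{\infty,n}\;\cong\;\mathbb Z_p^n\rtimes B_n\;\cong\;\Big(\varprojlim_r C_r^n\Big)\rtimes B_n .$$ Moreover, $\mathcal F_n=\mathbb Z^n\rtimes B_n$ is dense in $\mathbb Z_p^n\times B_n$ (the underlying topological space of $\mathbb Z_p^n\rtimes B_n$), and the identification in $\mathcal F_{\infty,n}$ of $\mathcal F_n=\mathbb Z^n\rtimes B_n$ is dense in $\mathcal F_{\infty,n}$. Finally, the identification in $\mathcal F_{\infty,n}$ of the set $A=\{\mathbf t_1,\sigma_1,\ldots,\sigma_{n-1}\}\subset\mathcal F_n$ is a set of topological generators of $\mathcal F_{\infty,n}$.
   Context: Inverse systems are indexed by $\mathbb N=\{1,2,\ldots\}$. Sets with no specified topology are discrete; products carry the product topology and inverse limits the subspace topology. $C_r=\langle t_r\,;\,t_r^{p^r}=1\rangle$ is the multiplicative cyclic group of order $p^r$; for $r\ge s$ the connecting map $\theta^r_s:C_r\to C_s$ sends $t_r\mapsto t_s$. The $p$-adic integers are $\mathbb Z_p=\varprojlim C_r$ (written multiplicatively). $t_{r,i}\in C_r^n$ is the element with $t_r$ in position $i$ and $1$ elsewhere; $\pi^r_s:C_r^n\to C_s^n$ ($r\ge s$) is the homomorphism $t_{r,i}\mapsto t_{s,i}$. $B_n$ is the braid group on $n$ strands with standard generators $\sigma_1,\ldots,\sigma_{n-1}$, with the discrete topology. For a group $A$, $B_n$ acts on $A^n$ by permuting coordinates via the natural projection $B_n\to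 S_n$, $\sigma_i\mapsto(i,i+1)$ (so $\sigma_i$ exchanges the $i$-th and $(i+1)$-st coordinates), and $A^n\rtimes B_n$ has multiplication $(a,\sigma)(b,\tau)=(a\,\sigma(b),\sigma\tau)$. The classical framed braid group is $\mathcal F_n=\mathbb Z^n\rtimes B_n$ and the modular framed braid group is $\mathcal F_{p^r,n}=C_r^n\rtimes B_n$. The maps $\pi^r_s\cdot\mathrm{id}:\mathcal F_{p^r,n}\to\mathcal F_{p^s,n}$, $(x,\sigma)\mapsto(\pi^r_s(x),\sigma)$, form an inverse system of topological groups, and the $p$-adic framed braid group is $\mathcal F_{\infty,n}:=\varprojlim\mathcal F_{p^r,n}$. Put $\mathbf t=(t_1,t_2,\ldots)\in\varprojlim C_r$, and let $\mathbf t_i\in\mathbb Z_p^n$ be the element with $\mathbf t$ in position $i$ and the identity elsewhere. The subgroup $\mathbb Z^n$ of $\mathbb Z_p^n$ is $\langle\mathbf t_1,\ldots,\mathbf t_n\rangle$, and $\mathcal F_n=\mathbb Z^n\rtimes B_n\subset\mathbb Z_p^n\rtimes B_n$. Identifications between $\mathcal F_{\infty,n}$ and $\mathbb Z_p^n\rtimes B_n$ are the natural ones: the sequence $((w_1,\sigma),(w_2,\sigma),\ldots)$ with $w_r=(w_{r1},\ldots,w_{rn})\in C_r^n$ corresponds to $\big(((w_{r1})_r,\ldots,(w_{rn})_r),\sigma\big)$. Thus $\mathbf t_1$ corresponds to the sequence $(t_{r,1})_r$ and $\sigma_i$ to the constant sequence. A subset $S$ of an inverse limit of groups is a set of topological generators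 if the subgroup $\langle S\rangle$ it generates is dense. *)

(* Defs.v *)
From HB Require Import structures.
From mathcomp Require Import all_boot all_order all_algebra fingroup perm.
From mathcomp Require Import generic_quotient.
From mathcomp Require Import zify.
From mathcomp Require Import all_classical topology.

Set Implicit Arguments.
Unset Strict Implicit.
Unset Printing Implicit Defensive.

Local Open Scope classical_set_scope.
Local Open Scope quotient_scope.
Local Open Scope group_scope.

HB.mixin Record isTopologicalGroup G of monoid.Group G & Topological G := {
  mulg_continuous : continuous (fun x : G * G => x.1 * x.2);
  invg_continuous : continuous (fun x : G => x^-1) }.

#[short(type="topologicalGroupType")]
HB.structure Definition TopologicalGroup :=
  {G of monoid.Group G & Topological G & isTopologicalGroup G}.

Definition subgroup (G : groupType) (H : set G) :=
  H 1 /\ forall x y, H x -> H y -> H (x * y^-1).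

Definition generated (G : groupType) (S : set G) : set G :=
  smallest (@subgroup G) S.

Definition topological_generators (G : topologicalGroupType) (S : set G) :=
  dense (generated S).

Definition group_iso (G H : groupType) (f : G -> H) :=
  bijective f /\ {morph f : x y / x * y}.

Section Continuity.
Variables U V W : topologicalType.

Lemma comp_continuous (f : U -> V) (g : V -> W) :
  continuous f -> continuous g -> continuous (fun u => g (f u)).
Proof. by move=> cf cg u; exact: (cvg_comp _ _ (cf u) (cg (f u))). Qed.

Lemma pair_continuous (f : U -> V) (g : U -> W) :
  continuous f -> continuous g -> continuous (fun u => (f u, g u)).
Proof. by move=> cf cg u; exact: (cvg_pair (cf u) (cg u)). Qed.

Lemma proj1_continuous : continuous (fun x : U * V => x.1).
Proof. by move=> x; exact: cvg_fst. Qed.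

Lemma proj2_continuous : continuous (fun x : U * V => x.2).
Proof. by move=> x; exact: cvg_snd. Qed.
End Continuity.

Lemma mul_continuous (U : topologicalType) (G : topologicalGroupType)
  (f g : U -> G) :
  continuous f -> continuous g -> continuous (fun u => f u * g u).
Proof.
move=> cf cg.
exact: (comp_continuous (pair_continuous cf cg) (@mulg_continuous G)).
Qed.

Lemma inv_continuous (U : topologicalType) (G : topologicalGroupType)
  (f : U -> G) : continuous f -> continuous (fun u => (f u)^-1).
Proof. by move=> cf; exact: (comp_continuous cf (@invg_continuous G)). Qed.

Definition discrete_group (G : groupType) : Type := discrete_topology G.

Section DiscreteGroup.
Variable G : groupType.
HB.instance Definition _ := DiscreteTopology.copy (discrete_group G)
  (discrete_topology G).
HB.instance Definition _ := monoid.Group.copy (discrete_group G) G.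

Lemma discrete_continuous (T : discreteTopologicalType) (U : topologicalType)
  (f : T -> U) : continuous f.
Proof.
by move=> x A /nbhs_singleton Afx; apply: filterS (discrete_set1 x) => _ ->.
Qed.

Lemma discrete_pair_continuous (T : discreteTopologicalType)
    (U V : topologicalType) (f : T * U -> V) :
  (forall t, continuous (fun u => f (t, u))) -> continuous f.
Proof.
move=> cf [t u] A /(cf t u) /= fA.
exists ([set t], [set v | A (f (t, v))]) => //=.
  by split=> //=; exact: discrete_set1.
by move=> [t' v] /= [-> ].
Qed.

Let discrete_mulg : continuous (fun x : discrete_group G * discrete_group G =>
  x.1 * x.2 : discrete_group G).
Proof.
by apply: discrete_pair_continuous => t; exact: discrete_continuous.
Qed.

HB.instance Definition _ := isTopologicalGroup.Build (discrete_group G)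
  discrete_mulg (@discrete_continuous _ (discrete_group G) _).
End DiscreteGroup.

Section ProdGroup.
Variables (I : Type) (T : I -> topologicalGroupType).
Local Notation P := (prod_topology T).

Let oneP : P := fun i => 1.
Let invP (x : P) : P := fun i => (x i)^-1.
Let mulP (x y : P) : P := fun i => x i * y i.

Let mulPA : associative mulP.
Proof. by move=> x y z; apply: functional_extensionality_dep => i; apply: mulgA. Qed.
Let mul1P : left_id oneP mulP.
Proof. by move=> x; apply: functional_extensionality_dep => i; apply: mul1g. Qed.
Let mulP1 : right_id oneP mulP.
Proof. by move=> x; apply: functional_extensionality_dep => i; apply: mulg1. Qed.
Let mulVP : left_inverse oneP invP mulP.
Proof. by move=> x; apply: functional_extensionality_dep => i; apply: mulVg. Qed.
Let mulPV : right_inverse oneP invP mulP.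
Proof. by move=> x; apply: functional_extensionality_dep => i; apply: mulgV. Qed.

HB.instance Definition _ := isGroup.Build P mulPA mul1P mulP1 mulVP mulPV.

Lemma prod_proj_continuous i : continuous (fun x : P => x i).
Proof.
move=> x A Axi; have /cvg_sup/(_ i) cvx := @cvg_id _ (nbhs (x : P)).
apply: (cvx ((fun y : P => y i) @^-1` A)).
by apply: (@initial_continuous _ _ (fun f : forall j, T j => f i)).
Qed.

Lemma prod_continuous (U : topologicalType) (f : U -> P) :
  (forall i, continuous (fun u => f u i)) -> continuous f.
Proof.
move=> cf u; apply/cvg_sup => i A [_ [[B oB <-] Bfu] BA].
apply: (filterS BA); apply: cf; exact: open_nbhs_nbhs.
Qed.

Let mulP_continuous : continuous (fun x : P * P => x.1 * x.2).
Proof.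
apply: prod_continuous => i; apply: mul_continuous.
  exact: (comp_continuous (@proj1_continuous P P) (@prod_proj_continuous i)).
exact: (comp_continuous (@proj2_continuous P P) (@prod_proj_continuous i)).
Qed.
Let invP_continuous : continuous (fun x : P => x^-1).
Proof.
by apply: prod_continuous => i; exact: inv_continuous (@prod_proj_continuous i).
Qed.

HB.instance Definition _ :=
  isTopologicalGroup.Build P mulP_continuous invP_continuous.
End ProdGroup.

Definition power (n : nat) (A : topologicalGroupType) :=
  prod_topology (fun _ : 'I_n => A).
HB.instance Definition _ n A := TopologicalGroup.on (power n A).

(* Inverse systems are indexed by {1, 2, ...}; the object [X r] with
   [r : nat] stands for the one of index [r + 1]. *)
Record inv_system := InvSystem {
  obj :> nat -> topologicalGroupType;
  bond : forall r s, (s <= r)%N -> obj r -> obj s;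
  bondM : forall r s (le_sr : (s <= r)%N), {morph bond le_sr : x y / x * y};
  bond_continuous : forall r s (le_sr : (s <= r)%N), continuous (bond le_sr);
  bond_id : forall r (le_rr : (r <= r)%N) x, bond le_rr x = x;
  bond_comp : forall r s u (le_sr : (s <= r)%N) (le_us : (u <= s)%N)
    (le_ur : (u <= r)%N) x, bond le_us (bond le_sr x) = bond le_ur x }.

Definition coherent (X : inv_system) : set (prod_topology (fun r => X r)) :=
  [set x | forall r s (le_sr : (s <= r)%N), bond le_sr (x r) = x s].

Arguments coherent : clear implicits.

Definition invlim (X : inv_system) : Type := set_type (coherent X).

Definition to_invlim (X : inv_system) (x : forall r, X r)
    (cx : coherent X x) : invlim X :=
  exist (fun y => y \in coherent X) x (mem_set cx).

Section Invlim.
Variable X : inv_system.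

HB.instance Definition _ := Topological.on (invlim X).
HB.instance Definition _ := SubChoice.on (invlim X).

Lemma bond1 r s (le_sr : (s <= r)%N) : bond (i := X) le_sr 1 = 1.
Proof. by apply: (mulgI (bond le_sr 1)); rewrite -bondM !mulg1. Qed.

Lemma bondV r s (le_sr : (s <= r)%N) : {morph bond (i := X) le_sr : x / x^-1}.
Proof.
by move=> x; apply: (mulgI (bond le_sr x)); rewrite -bondM !mulgV bond1.
Qed.

Let coherent_group : group_closed (fun x => x \in coherent X).
Proof.
split=> [|x y].
  by apply/mem_set => r s le_sr; exact: bond1.
move=> /set_mem cx /set_mem cy; apply/mem_set => r s le_sr.
by rewrite [LHS]bondM bondV cx cy.
Qed.
HB.instance Definition _ :=
  SubChoice_isSubGroup.Build _ _ (invlim X) coherent_group.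

Lemma invlim_val_continuous :
  continuous (fun x : invlim X => val x : prod_topology (fun r => X r)).
Proof. exact: initial_continuous. Qed.

Lemma invlim_continuous (U : topologicalType) (f : U -> invlim X) :
  (forall r, continuous (fun u => val (f u) r)) -> continuous f.
Proof.
move=> cf; apply: continuous_comp_initial.
exact: (@prod_continuous _ (fun r => X r)).
Qed.

Lemma invlim_proj_continuous r : continuous (fun x : invlim X => val x r).
Proof.
exact: (comp_continuous invlim_val_continuous
  (@prod_proj_continuous _ (fun r => X r) r)).
Qed.

Let invlim_mulg : continuous (fun x : invlim X * invlim X => x.1 * x.2).
Proof.
apply: invlim_continuous => r; apply: mul_continuous.
  exact: (comp_continuous (@proj1_continuous _ _) (@invlim_proj_continuous r)).
exact: (comp_continuous (@proj2_continuous _ _) (@invlim_proj_continuous r)).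
Qed.
Let invlim_invg : continuous (fun x : invlim X => x^-1).
Proof.
apply: invlim_continuous => r.
exact: inv_continuous (@invlim_proj_continuous r).
Qed.
HB.instance Definition _ :=
  isTopologicalGroup.Build (invlim X) invlim_mulg invlim_invg.

End Invlim.

Record action (H N : topologicalGroupType) := Action {
  act :> H -> N -> N;
  act1 : forall x, act 1 x = x;
  actM : forall g h x, act (g * h) x = act g (act h x);
  act_mul : forall h, {morph act h : x y / x * y};
  act_continuous : continuous (fun z : H * N => act z.1 z.2) }.

Definition sdprod (H N : topologicalGroupType) (a : action H N) : Type :=
  (N * H)%type.

Section SemidirectProduct.
Variables (H N : topologicalGroupType) (a : action H N).
Local Notation S := (sdprod a).

HB.instance Definition _ := Topological.copy S (N * H)%type.

Let oneS : S := (1, 1).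
Let mulS (x y : S) : S := (x.1 * a x.2 y.1, x.2 * y.2).
Let invS (x : S) : S := (a x.2^-1 x.1^-1, x.2^-1).

Lemma act_one h : a h 1 = 1.
Proof. by apply: (mulgI (a h 1)); rewrite -act_mul !mulg1. Qed.

Let mulSA : associative mulS.
Proof. by move=> x y z; rewrite /mulS /= !actM act_mul !mulgA. Qed.
Let mul1S : left_id oneS mulS.
Proof. by case=> x h; rewrite /mulS /= act1 !mul1g. Qed.
Let mulS1 : right_id oneS mulS.
Proof. by case=> x h; rewrite /mulS /= act_one !mulg1. Qed.
Let mulVS : left_inverse oneS invS mulS.
Proof. by case=> x h; rewrite /mulS /= -act_mul !mulVg act_one. Qed.
Let mulSV : right_inverse oneS invS mulS.
Proof. by case=> x h; rewrite /mulS /= -actM !mulgV act1 mulgV. Qed.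

HB.instance Definition _ := isGroup.Build S mulSA mul1S mulS1 mulVS mulSV.

Lemma sdprod_fst_continuous : continuous (fun x : S => x.1).
Proof. exact: (@proj1_continuous N H). Qed.
Lemma sdprod_snd_continuous : continuous (fun x : S => x.2).
Proof. exact: (@proj2_continuous N H). Qed.

Lemma sdprod_pair_continuous (U : topologicalType) (f : U -> N) (g : U -> H) :
  continuous f -> continuous g -> continuous (fun u => (f u, g u) : S).
Proof. exact: pair_continuous. Qed.

Let act_comp_continuous (U : topologicalType) (f : U -> H) (g : U -> N) :
  continuous f -> continuous g -> continuous (fun u => a (f u) (g u)).
Proof.
move=> cf cg.
exact: (@comp_continuous U (H * N)%type N _ (fun z => a z.1 z.2)
  (pair_continuous cf cg) (@act_continuous _ _ a)).
Qed.

Let mulS_continuous : continuous (fun x : S * S => x.1 * x.2).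
Proof.
have c11 := comp_continuous (@proj1_continuous S S) sdprod_fst_continuous.
have c12 := comp_continuous (@proj1_continuous S S) sdprod_snd_continuous.
have c21 := comp_continuous (@proj2_continuous S S) sdprod_fst_continuous.
have c22 := comp_continuous (@proj2_continuous S S) sdprod_snd_continuous.
exact: (pair_continuous (mul_continuous c11 (act_comp_continuous c12 c21))
  (mul_continuous c12 c22)).
Qed.
Let invS_continuous : continuous (fun x : S => x^-1).
Proof.
have c2 := inv_continuous sdprod_snd_continuous.
exact: (pair_continuous
  (act_comp_continuous c2 (inv_continuous sdprod_fst_continuous)) c2).
Qed.

HB.instance Definition _ :=
  isTopologicalGroup.Build S mulS_continuous invS_continuous.
End SemidirectProduct.

Section Braid.
Variable n : nat.

(* The letter [(i, false)] is the generator sigma_(i + 1), exchanging the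
   strands [i] and [i + 1] (numbered from 0), and [(i, true)] is its inverse. *)
Definition braid_word := seq ('I_n.-1 * bool).

Local Notation s i := (i, false).

Inductive braid_eq : braid_word -> braid_word -> Prop :=
| BraidRefl u : braid_eq u u
| BraidSym u v : braid_eq u v -> braid_eq v u
| BraidTrans u v w : braid_eq u v -> braid_eq v w -> braid_eq u w
| BraidCat u u' v v' :
    braid_eq u u' -> braid_eq v v' -> braid_eq (u ++ v) (u' ++ v')
| BraidCancel i b : braid_eq [:: (i, b); (i, ~~ b)] [::]
| BraidComm (i j : 'I_n.-1) : (i.+1 < j)%N ->
    braid_eq [:: s i; s j] [:: s j; s i]
| BraidRel (i j : 'I_n.-1) : j = i.+1 :> nat ->
    braid_eq [:: s i; s j; s i] [:: s j; s i; s j].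

Definition braid_eqb : rel braid_word := fun u v => `[< braid_eq u v >].

Lemma braid_eqb_refl : reflexive braid_eqb.
Proof. by move=> u; apply/asboolP; exact: BraidRefl. Qed.
Lemma braid_eqb_sym : symmetric braid_eqb.
Proof. by move=> u v; apply/asboolP/asboolP; exact: BraidSym. Qed.
Lemma braid_eqb_trans : transitive braid_eqb.
Proof.
by move=> v u w /asboolP uv /asboolP vw; apply/asboolP; exact: BraidTrans vw.
Qed.
Canonical braid_equiv :=
  EquivRel braid_eqb braid_eqb_refl braid_eqb_sym braid_eqb_trans.

Definition braid_quot : Type := {eq_quot braid_equiv}.
HB.instance Definition _ := Choice.on braid_quot.

Definition braid_class (w : braid_word) : braid_quot :=
  \pi_({eq_quot braid_equiv}) w.
Definition braid_repr (x : braid_quot) : braid_word :=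
  repr (x : {eq_quot braid_equiv}).

Lemma braid_reprK : cancel braid_repr braid_class.
Proof. exact: reprK. Qed.

Lemma braid_classP u v : braid_class u = braid_class v <-> braid_eq u v.
Proof.
split=> [/eqP|uv]; first by rewrite /braid_class piE => /asboolP.
by apply/eqP; rewrite /braid_class piE; exact/asboolP.
Qed.

Lemma braid_repr_class w : braid_eq (braid_repr (braid_class w)) w.
Proof. by apply/braid_classP; rewrite braid_reprK. Qed.

Definition braid_word_inv (w : braid_word) : braid_word :=
  rev [seq (x.1, ~~ x.2) | x <- w].

Lemma braid_word_invK : involutive braid_word_inv.
Proof.
move=> w; rewrite /braid_word_inv map_rev revK -map_comp -[RHS]map_id.
by apply: eq_map => -[i b] /=; rewrite negbK.
Qed.

Lemma braid_word_invM u v :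
  braid_word_inv (u ++ v) = braid_word_inv v ++ braid_word_inv u.
Proof. by rewrite /braid_word_inv map_cat rev_cat. Qed.

Lemma braid_word_mulV w : braid_eq (w ++ braid_word_inv w) [::].
Proof.
elim: w => [|[i b] w IH]; first exact: BraidRefl.
have -> : ((i, b) :: w) ++ braid_word_inv ((i, b) :: w) =
    [:: (i, b)] ++ (w ++ braid_word_inv w) ++ [:: (i, ~~ b)].
  by rewrite -cat1s braid_word_invM -!catA.
apply: BraidTrans (BraidCancel i b).
exact: (BraidCat (BraidRefl [:: _]) (BraidCat IH (BraidRefl [:: _]))).
Qed.

Let oneB : braid_quot := braid_class [::].
Let mulB (x y : braid_quot) := braid_class (braid_repr x ++ braid_repr y).
Let invB (x : braid_quot) := braid_class (braid_word_inv (braid_repr x)).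

Let mulBE u v : mulB (braid_class u) (braid_class v) = braid_class (u ++ v).
Proof. by apply/braid_classP; apply: BraidCat; exact: braid_repr_class. Qed.

Let mulBA : associative mulB.
Proof.
move=> x y z; rewrite -[x]braid_reprK -[y]braid_reprK -[z]braid_reprK.
by rewrite !mulBE catA.
Qed.
Let mul1B : left_id oneB mulB.
Proof. by move=> x; rewrite -[x]braid_reprK mulBE. Qed.
Let mulB1 : right_id oneB mulB.
Proof. by move=> x; rewrite -[x]braid_reprK mulBE cats0. Qed.
Let mulBV : right_inverse oneB invB mulB.
Proof.
move=> x; rewrite -{1}[x]braid_reprK mulBE; apply/braid_classP.
exact: braid_word_mulV.
Qed.
Let mulVB : left_inverse oneB invB mulB.
Proof.
move=> x; rewrite -{2}[x]braid_reprK mulBE; apply/braid_classP.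
rewrite -{2}[braid_repr x]braid_word_invK; exact: braid_word_mulV.
Qed.

HB.instance Definition _ := isGroup.Build braid_quot mulBA mul1B mulB1 mulVB mulBV.

Definition braid : Type := discrete_group braid_quot.
HB.instance Definition _ := TopologicalGroup.on braid.

Definition sigma (i : 'I_n.-1) : braid := braid_class [:: s i].

Definition strand (i : 'I_n.-1) : 'I_n := widen_ord (leq_pred n) i.
Lemma next_strand_proof (i : 'I_n.-1) : (i.+1 < n)%N.
Proof. by case: n i => [|m] [i]. Qed.
Definition next_strand (i : 'I_n.-1) : 'I_n := Ordinal (next_strand_proof i).

Definition word_perm (w : braid_word) : 'S_n :=
  \prod_(x <- w) tperm (strand x.1) (next_strand x.1).

Definition braid_perm (b : braid) : 'S_n := word_perm (braid_repr b).

Lemma word_perm_cat u v : word_perm (u ++ v) = word_perm u * word_perm v.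
Proof. exact: big_cat. Qed.

Lemma word_perm_eq u v : braid_eq u v -> word_perm u = word_perm v.
Proof.
elim=> {u v} [//|//|u v w _ -> _ -> //|u u' v v' _ eu _ ev|i b|i j lt_ij|i j eq_ij].
- by rewrite !word_perm_cat eu ev.
- by rewrite /word_perm !big_cons big_nil mulg1 tperm2.
- rewrite /word_perm !big_cons big_nil !mulg1.
  apply: (perm_onC (tperm_on _ _) (tperm_on _ _)).
  rewrite disjoint_subset; apply/fintype.subsetP => k; rewrite !inE -!val_eqE /=.
  by move: lt_ij; lia.
rewrite /word_perm !big_cons big_nil !mulg1 /=.
have -> : strand j = next_strand i by apply: val_inj; rewrite /= eq_ij.
set x := strand i; set y := next_strand i; set z := next_strand j.
have conj_tperm a b c d : tperm a b * (tperm c d * tperm a b) =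
    tperm (tperm a b c) (tperm a b d) :> 'S_n.
  by rewrite -tpermJ conjgE tpermV.
have [nxz nyz] : x != z /\ y != z.
  by rewrite -!val_eqE /= eq_ij; split; lia.
have nxy : x != y by rewrite -val_eqE /=; lia.
by rewrite !conj_tperm tpermR tpermL !tpermD // eq_sym.
Qed.

Lemma braid_permM : {morph braid_perm : x y / x * y}.
Proof.
move=> x y; rewrite /braid_perm -word_perm_cat; apply: word_perm_eq.
exact: braid_repr_class.
Qed.

Lemma braid_perm_sigma i :
  braid_perm (sigma i) = tperm (strand i) (next_strand i).
Proof.
rewrite /braid_perm (word_perm_eq (braid_repr_class _)).
by rewrite /word_perm big_seq1.
Qed.

End Braid.

Section PermAction.
Variables (n : nat) (A : topologicalGroupType).

(* Permutations compose from left to right, whence [(braid_perm b) i] rather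
   than its inverse: this is the left action for which [sigma i] exchanges the
   coordinates [strand i] and [next_strand i]. *)
Let pact (b : braid n) (x : power n A) : power n A :=
  fun i => x (braid_perm b i).

Let pact1 x : pact 1 x = x.
Proof.
rewrite /pact; have -> : braid_perm (1 : braid n) = 1; last first.
  by apply: functional_extensionality_dep => i; rewrite perm1.
by apply: (mulgI (braid_perm 1)); rewrite -braid_permM !mulg1.
Qed.
Let pactM b c x : pact (b * c) x = pact b (pact c x).
Proof.
by apply: functional_extensionality_dep => i; rewrite /pact braid_permM permM.
Qed.
Let pact_mul b : {morph pact b : x y / x * y}.
Proof. by []. Qed.
Let pact_continuous : continuous (fun z : braid n * power n A => pact z.1 z.2).
Proof.
apply: discrete_pair_continuous => b.
apply: (@prod_continuous _ (fun=> A)) => i.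
exact: (@prod_proj_continuous _ (fun=> A) (braid_perm b i)).
Qed.

Definition perm_act : action (braid n) (power n A) :=
  Action pact1 pactM pact_mul pact_continuous.
End PermAction.

Section Systems.
Variables (n : nat) (X : inv_system).

Let pbond r s (le_sr : (s <= r)%N) (x : power n (X r)) : power n (X s) :=
  fun i => bond le_sr (x i).

Let pbondM r s (le_sr : (s <= r)%N) : {morph pbond le_sr : x y / x * y}.
Proof.
by move=> x y; apply: functional_extensionality_dep => i; exact: bondM.
Qed.
Let pbond_continuous r s (le_sr : (s <= r)%N) : continuous (pbond le_sr).
Proof.
apply: (@prod_continuous _ (fun=> X s)) => i.
exact: (@comp_continuous (power n (X r)) (X r) (X s) (fun x => x i) _
  (@prod_proj_continuous _ (fun=> X r) i) (@bond_continuous X _ _ le_sr)).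
Qed.
Let pbond_id r (le_rr : (r <= r)%N) x : pbond le_rr x = x.
Proof. by apply: functional_extensionality_dep => i; exact: bond_id. Qed.
Let pbond_comp r s u (le_sr : (s <= r)%N) (le_us : (u <= s)%N)
  (le_ur : (u <= r)%N) x : pbond le_us (pbond le_sr x) = pbond le_ur x.
Proof. by apply: functional_extensionality_dep => i; exact: bond_comp. Qed.

Definition power_system : inv_system :=
  InvSystem pbondM pbond_continuous pbond_id pbond_comp.

Local Notation F r := (sdprod (perm_act n (X r))).

Let fbond r s (le_sr : (s <= r)%N) (x : F r) : F s := (pbond le_sr x.1, x.2).

Let fbondM r s (le_sr : (s <= r)%N) : {morph fbond le_sr : x y / x * y}.
Proof. by move=> x y; rewrite /fbond pbondM. Qed.
Let fbond_continuous r s (le_sr : (s <= r)%N) : continuous (fbond le_sr).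
Proof.
apply: (@sdprod_pair_continuous _ _ _ (F r) (fun x => pbond le_sr x.1) (fun x => x.2)).
  exact: (@comp_continuous (F r) _ _ (fun x => x.1) _
    (@sdprod_fst_continuous _ _ _) (@pbond_continuous r s le_sr)).
exact: sdprod_snd_continuous.
Qed.
Let fbond_id r (le_rr : (r <= r)%N) x : fbond le_rr x = x.
Proof. by case: x => x b; rewrite /fbond pbond_id. Qed.
Let fbond_comp r s u (le_sr : (s <= r)%N) (le_us : (u <= s)%N)
  (le_ur : (u <= r)%N) x : fbond le_us (fbond le_sr x) = fbond le_ur x.
Proof. by rewrite /fbond pbond_comp. Qed.

Definition framed_system : inv_system :=
  InvSystem fbondM fbond_continuous fbond_id fbond_comp.

Let lact_coherent (b : braid n) (x : invlim power_system) :
  coherent power_system (fun r => perm_act n (X r) b (val x r)).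
Proof. by move=> r s le_sr; rewrite -(set_mem (valP x) r s le_sr). Qed.

Let lact (b : braid n) (x : invlim power_system) : invlim power_system :=
  to_invlim (lact_coherent b x).

Let lact1 x : lact 1 x = x.
Proof.
by apply: val_inj; apply: functional_extensionality_dep => r; exact: act1.
Qed.
Let lactM b c x : lact (b * c) x = lact b (lact c x).
Proof.
by apply: val_inj; apply: functional_extensionality_dep => r; exact: actM.
Qed.
Let lact_mul b : {morph lact b : x y / x * y}.
Proof.
by move=> x y; apply: val_inj; apply: functional_extensionality_dep => r;
  exact: act_mul.
Qed.
Let lact_continuous :
  continuous (fun z : braid n * invlim power_system => lact z.1 z.2).
Proof.
apply: discrete_pair_continuous => b; apply: invlim_continuous => r.
apply: (@prod_continuous _ (fun=> X r)) => i.
exact: (comp_continuous (@invlim_proj_continuous power_system r)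
  (@prod_proj_continuous _ (fun=> X r) (braid_perm b i))).
Qed.

Definition lim_act : action (braid n) (invlim power_system) :=
  Action lact1 lactM lact_mul lact_continuous.

Lemma power_lim_coherent (x : power n (invlim X)) :
  coherent power_system (fun r i => val (x i) r).
Proof.
move=> r s le_sr; apply: functional_extensionality_dep => i.
exact: (set_mem (valP (x i)) r s le_sr).
Qed.

Definition power_lim (x : power n (invlim X)) : invlim power_system :=
  to_invlim (power_lim_coherent x).

Definition framed_to_power_lim (x : sdprod (perm_act n (invlim X))) :
  sdprod lim_act := (power_lim x.1, x.2).

Lemma framed_lim_coherent (x : sdprod (perm_act n (invlim X))) :
  coherent framed_system (fun r => (fun i => val (x.1 i) r, x.2) : F r).
Proof.
move=> r s le_sr; congr (_, _).
exact: (power_lim_coherent x.1 le_sr).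
Qed.

Definition framed_to_framed_lim (x : sdprod (perm_act n (invlim X))) :
  invlim framed_system := to_invlim (framed_lim_coherent x).

End Systems.

(* For p >= 2, [C p r] is the cyclic group of order p^(r + 1), the group law
   [*] being the addition of residues, with generator [t p r]; 'Z_m is Z/2 for
   m < 2. *)
Definition C (p r : nat) : Type := discrete_group 'Z_(p ^ r.+1).
HB.instance Definition _ p r := TopologicalGroup.on (C p r).

Definition t (p r : nat) : C p r := (1%R : 'Z_(p ^ r.+1)).

Definition theta (p r s : nat) (x : C p r) : C p s :=
  inZp (nat_of_ord (x : 'Z_(p ^ r.+1))) : 'Z_(p ^ s.+1).

Section CSystem.
Variable p : nat.

Let Zp_dvd r s : (s <= r)%N ->
  ((Zp_trunc (p ^ s.+1)).+2 %| (Zp_trunc (p ^ r.+1)).+2)%N.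
Proof.
move=> le_sr; case: p => [|[|q]]; first by rewrite !exp0n.
  by rewrite !exp1n.
rewrite !Zp_cast ?dvdn_exp2l //; exact: (leq_trans _ (ltn_expl _ _)).
Qed.

Lemma thetaM r s (le_sr : (s <= r)%N) :
  {morph @theta p r s : x y / x * y}.
Proof.
move=> x y; apply: val_inj => /=.
by rewrite modn_dvdm ?Zp_dvd // modnDm.
Qed.

Let theta_id r (le_rr : (r <= r)%N) x : @theta p r r x = x.
Proof. exact: valZpK. Qed.

Let theta_comp r s u (le_sr : (s <= r)%N) (le_us : (u <= s)%N)
  (le_ur : (u <= r)%N) x : @theta p s u (@theta p r s x) = @theta p r u x.
Proof. by apply: val_inj => /=; rewrite modn_dvdm ?Zp_dvd. Qed.

Lemma theta_t r s (le_sr : (s <= r)%N) : theta s (t p r) = t p s.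
Proof. by apply: val_inj => /=; rewrite modn_dvdm ?Zp_dvd. Qed.

Lemma t_generates r (x : C p r) : exists k, x = t p r ^+ k.
Proof. by exists (nat_of_ord (x : 'Z_(p ^ r.+1))); rewrite -[LHS]Zp1_expgz. Qed.

Definition C_system : inv_system :=
  @InvSystem (C p) (fun r s _ => @theta p r s) thetaM
    (fun r s _ => @discrete_continuous (C p r) _ _) theta_id theta_comp.

Lemma t_coherent : coherent C_system (t p).
Proof. by move=> r s; exact: theta_t. Qed.

Definition padic : topologicalGroupType := invlim C_system.

Definition bold_t : padic := to_invlim t_coherent.
End CSystem.

Section PadicFramedBraid.
Variables p n : nat.

Definition bold_ti (i : 'I_n) : power n (padic p) :=
  fun j => if j == i then bold_t p else 1.

(* The copy of Z^n in the n-th power of the p-adic integers. *)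
Definition Z_power : set (power n (padic p)) := generated (range bold_ti).

Definition padic_sdprod : topologicalGroupType := sdprod (perm_act n (padic p)).

Definition framed_braid : set padic_sdprod := [set x | Z_power x.1].

Definition framed_generators (i : 'I_n) : set padic_sdprod :=
  [set (bold_ti i, 1) : padic_sdprod] `|`
  range (fun j => (1, sigma j) : padic_sdprod).

Definition padic_framed_braid : topologicalGroupType :=
  invlim (framed_system n (C_system p)).

Definition to_padic_framed_braid : padic_sdprod -> padic_framed_braid :=
  @framed_to_framed_lim n (C_system p).

Definition lim_sdprod : topologicalGroupType := sdprod (lim_act n (C_system p)).

Definition to_lim_sdprod : padic_sdprod -> lim_sdprod :=
  @framed_to_power_lim n (C_system p).
End PadicFramedBraid.

Arguments framed_braid : clear implicits.
Arguments framed_generators p {n} i.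
Arguments to_padic_framed_braid : clear implicits.
Arguments to_lim_sdprod : clear implicits.

(* Main.v *)
From mathcomp Require Import perm.
Require Import Defs.
From mathcomp Require Import all_boot all_classical topology.

(** The two isomorphisms only rearrange data. A coherent sequence
    [((w_r, b_r))_r] has a constant braid component, because the bonding maps of
    the framed system fix it; reading the remaining components coordinate by
    coordinate gives n coherent sequences, that is, an element of the n-th power
    of the p-adic integers. The inverse [framed_of_framed_lim] so obtained is
    moreover continuous.

    Density in an inverse limit can be tested one level at a time
    ([dense_invlim]): a set is dense as soon as at every level it takes every
    value that the limit takes there. For the framed braids this holds because t_r
    generates C_r: given (w, b) at level r, write w_i = t_r ^ c_i and lift it to
    the framed braid (t ^ c_1, ..., t ^ c_n; b) ([framed_braid_image_dense]).
    Density in the product of the p-adic power and the braid group follows by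
    transport along the continuous surjection [framed_of_framed_lim].

    Finally t_1 and the sigma_j generate all framed braids
    ([framed_braid_generated]): conjugating t_i by sigma_i exchanges two
    coordinates and gives t_(i+1), so every t_i is reached. The generated
    subgroup therefore contains a dense set. *)

Local Open Scope classical_set_scope.
Local Open Scope group_scope.

Set Implicit Arguments.
Unset Strict Implicit.
Unset Printing Implicit Defensive.

(** * Generated subgroups *)

Section Generation.
Variable G : groupType.
Implicit Types (S H : set G).

Lemma subgroupM H x y : subgroup H -> H x -> H y -> H (x * y).
Proof.
move=> [H1 Hdiv] Hx Hy; rewrite -[y]invgK; apply: (Hdiv) => //.
by rewrite -[y^-1]mul1g; exact: Hdiv.
Qed.

Lemma subgroupV H x : subgroup H -> H x -> H x^-1.
Proof. by move=> [H1 Hdiv] Hx; rewrite -[x^-1]mul1g; exact: Hdiv. Qed.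

Lemma subgroupX H x k : subgroup H -> H x -> H (x ^+ k).
Proof.
move=> sH Hx; elim: k => [|k IH]; first by case: sH.
by rewrite expgS; exact: subgroupM.
Qed.

Lemma generated_subgroup S : subgroup (generated S).
Proof.
split=> [H [[H1 _] _] //|x y Sx Sy H HS].
by have [[_ Hdiv] _] := HS; apply: Hdiv; [exact: Sx | exact: Sy].
Qed.

Lemma sub_generated S : S `<=` generated S.
Proof. exact: sub_smallest. Qed.

Lemma generated_min S H : subgroup H -> S `<=` H -> generated S `<=` H.
Proof. by move=> sH SH x; apply. Qed.
End Generation.

Lemma preimage_subgroup (G K : groupType) (f : G -> K) (H : set K) :
  {morph f : x y / x * y} -> subgroup H -> subgroup (f @^-1` H).
Proof.
move=> fM [H1 Hdiv].
have f1 : f 1 = 1 by apply: (mulgI (f 1)); rewrite -fM !mulg1.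
have fV x : f x^-1 = (f x)^-1 by apply: (mulgI (f x)); rewrite -fM !mulgV.
by split=> [|x y Hx Hy] /=; rewrite ?f1 // fM fV; exact: Hdiv.
Qed.

Lemma image_generated (G K : groupType) (f : G -> K) (S : set G) :
  {morph f : x y / x * y} -> f @` generated S `<=` generated (f @` S).
Proof.
move=> fM _ [x Sx <-].
apply: (@generated_min _ S (f @^-1` generated (f @` S))) Sx.
  exact: (preimage_subgroup fM (generated_subgroup _)).
by move=> y Sy; apply: sub_generated; exists y.
Qed.

(** * Density in inverse limits *)

Lemma denseS (T : topologicalType) (A B : set T) : A `<=` B -> dense A -> dense B.
Proof.
move=> AB dA O O0 oO; have [x [Ox Ax]] := dA O O0 oO.
by exists x; split=> //; exact: AB.
Qed.

Lemma dense_image (T U : topologicalType) (f : T -> U) (A : set T) :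
  continuous f -> (forall y, exists x, f x = y) -> dense A -> dense (f @` A).
Proof.
move=> /continuousP cf fsurj dA O [y Oy] oO.
have [x fxy] := fsurj y.
have [|z [Ofz Az]] := dA (f @^-1` O) _ (cf O oO).
  by exists x; rewrite /= fxy.
by exists (f z); split=> //; exists z.
Qed.

(** Agreement at level k forces agreement at all lower levels, so approximants
    [y k] of [x] that agree with it at level k form a sequence whose every
    coordinate is eventually equal to that of [x]; hence [y] converges to [x],
    whatever the topologies of the objects. *)
Lemma dense_invlim (X : inv_system) (S : set (invlim X)) :
  (forall (x : invlim X) k, exists2 y : invlim X, S y & val y k = val x k) ->
  dense S.
Proof.
move=> appr O [x Ox] oO.
have /choice [y yP] : forall k, exists y : invlim X, S y /\ val y k = val x k.
  by move=> k; have [y Sy yx] := appr x k; exists y.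
have yx : y @ \oo --> x.
  move=> A [_ [[B oB <-] Bx] BA]; apply: (filterS BA).
  have : (fun k => val (y k) : prod_topology (fun r => X r)) @ \oo --> val x.
    apply/cvg_sup => r D [_ [[E oE <-] Ex] ED]; apply: (filterS ED).
    exists r => // k /= le_rk.
    rewrite /= -(set_mem (valP (y k)) k r le_rk) (yP k).2.
    by rewrite (set_mem (valP x) k r le_rk).
  by apply; exact: open_nbhs_nbhs.
have [N _ /(_ N (leqnn N)) ON] := yx O (open_nbhs_nbhs (conj oO Ox)).
by exists (y N); split=> //; exact: (yP N).1.
Qed.

Lemma valM (X : inv_system) (x y : invlim X) r :
  val (x * y) r = val x r * val y r.
Proof. by []. Qed.

Lemma valX (X : inv_system) (x : invlim X) k r :
  val (x ^+ k) r = val x r ^+ k.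
Proof. by elim: k => [//|k IH]; rewrite !expgS valM IH. Qed.

(** * Rearranging coherent sequences *)

Section Isomorphisms.
Variables (n : nat) (X : inv_system).

Lemma framed_lim_snd (y : invlim (framed_system n X)) r s :
  (val y r).2 = (val y s).2.
Proof.
have e k : (val y k).2 = (val y 0).2.
  by rewrite -(set_mem (valP y) k 0 (leq0n k)).
by rewrite e [RHS]e.
Qed.

Lemma framed_lim_coord_coherent (y : invlim (framed_system n X)) i :
  coherent X (fun r => (val y r).1 i).
Proof. by move=> r s le_sr; rewrite -(set_mem (valP y) r s le_sr). Qed.

Definition framed_of_framed_lim (y : invlim (framed_system n X)) :
    sdprod (perm_act n (invlim X)) :=
  (fun i => to_invlim (framed_lim_coord_coherent y i), (val y 0).2).

Lemma framed_to_framed_limK :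
  cancel (@framed_to_framed_lim n X) framed_of_framed_lim.
Proof.
move=> [x b]; congr (_, _).
by apply: functional_extensionality_dep => i; exact: val_inj.
Qed.

Lemma framed_of_framed_limK :
  cancel framed_of_framed_lim (@framed_to_framed_lim n X).
Proof.
move=> y; apply: val_inj; apply: functional_extensionality_dep => r.
rewrite [RHS]surjective_pairing [in RHS](framed_lim_snd y r 0).
by [].
Qed.

Lemma framed_to_framed_limM :
  {morph @framed_to_framed_lim n X : x y / x * y}.
Proof.
by move=> x y; apply: val_inj; apply: functional_extensionality_dep.
Qed.

(** By this continuity, density passes from the limit of the framed groups to
    the product of the p-adic power and the braid group. *)
Lemma framed_of_framed_lim_continuous :
  continuous (framed_of_framed_lim
    : _ -> (power n (invlim X) * braid n)%type).
Proof.
pose F r : topologicalGroupType := sdprod (perm_act n (X r)).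
have proj r := @invlim_proj_continuous (framed_system n X) r.
apply: (@pair_continuous _ (power n (invlim X)) (braid n)
  (fun y i => to_invlim (framed_lim_coord_coherent y i))
  (fun y => (val y 0).2)); last first.
  exact: (@comp_continuous _ (F 0) _ _ _ (proj 0) (@sdprod_snd_continuous _ _ _)).
apply: (@prod_continuous _ (fun=> invlim X)) => i; apply: invlim_continuous => r.
apply: (@comp_continuous _ (F r) _ _ (fun z => z.1 i) (proj r)).
exact: (@comp_continuous (F r) (power n (X r)) (X r) _ (fun z => z i)
  (@sdprod_fst_continuous _ _ (perm_act n (X r))) (@prod_proj_continuous _ (fun=> X r) i)).
Qed.

Lemma power_lim_coord_coherent (y : invlim (power_system n X)) i :
  coherent X (fun r => val y r i).
Proof. by move=> r s le_sr; rewrite -(set_mem (valP y) r s le_sr). Qed.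

Lemma framed_to_framed_lim_iso : group_iso (@framed_to_framed_lim n X).
Proof.
split; last exact: framed_to_framed_limM.
exists framed_of_framed_lim; first exact: framed_to_framed_limK.
exact: framed_of_framed_limK.
Qed.

Lemma framed_to_power_lim_iso : group_iso (@framed_to_power_lim n X).
Proof.
split; last first.
  move=> x y; congr (_, _).
  by apply: val_inj; apply: functional_extensionality_dep.
exists (fun y => (fun i => to_invlim (power_lim_coord_coherent y.1 i), y.2)).
  move=> [x b]; congr (_, _).
  by apply: functional_extensionality_dep => i; exact: val_inj.
by move=> [y b]; congr (_, _); exact: val_inj.
Qed.

End Isomorphisms.

(** * The braid generators *)

Section Braids.
Variable n : nat.

Lemma braid_class_cat (u v : braid_word n) :
  braid_class (u ++ v) = braid_class u * braid_class v.
Proof.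
apply/braid_classP; apply: BraidCat; apply: BraidSym; exact: braid_repr_class.
Qed.

Lemma braid_class_nil : @braid_class n [::] = 1.
Proof. by []. Qed.

Lemma braid_generated (H : set (braid n)) :
  subgroup H -> range (@sigma n) `<=` H -> forall b, H b.
Proof.
move=> sH Hs b; rewrite -[b]braid_reprK.
elim: (braid_repr b) => [|[i e] w IH].
  by rewrite braid_class_nil; case: sH.
rewrite -cat1s braid_class_cat; apply: subgroupM => //.
have Hi : H (sigma i) by apply: Hs; exists i.
case: e => //.
have -> : braid_class [:: (i, true)] = (sigma i)^-1.
  apply: (@mulgI (braid n) (sigma i)).
  rewrite [LHS](esym (braid_class_cat _ _)) [RHS]mulgV.
  rewrite -[RHS]braid_class_nil.
  by apply/braid_classP; exact: (BraidCancel i false).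
exact: subgroupV.
Qed.
End Braids.

(** * The two factors of a semidirect product *)

Section SemidirectFactors.
Variables (H N : topologicalGroupType) (a : action H N).

Definition sd_kernel (x : N) : sdprod a := (x, 1).
Definition sd_complement (h : H) : sdprod a := (1, h).

Lemma sd_kernelM : {morph sd_kernel : x y / x * y}.
Proof. by move=> x y; congr (_, _); rewrite /= ?act1 ?mul1g. Qed.

Lemma sd_complementM : {morph sd_complement : h k / h * k}.
Proof. by move=> h k; congr (_, _); rewrite /= act_one mul1g. Qed.

Lemma sd_factor (z : sdprod a) : z = sd_kernel z.1 * sd_complement z.2.
Proof. by case: z => x h; congr (_, _); rewrite /= ?act1 ?mulg1 ?mul1g. Qed.

Lemma sd_conj h x :
  sd_complement h * sd_kernel x * (sd_complement h)^-1 = sd_kernel (a h x).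
Proof.
congr (_, _); rewrite /= ?mulg1 ?mulgV // mul1g.
by rewrite invg1 !act_one mulg1.
Qed.
End SemidirectFactors.

(** * Framed braids *)

Section Padic.
Variables p n : nat.

(** The element is the product of the [bold_ti i ^+ c i]; the induction
    multiplies in one coordinate at a time, since its partial products are
    explicit functions. *)
Lemma Z_power_coord (c : 'I_n -> nat) :
  @Z_power p n (fun i => bold_t p ^+ c i).
Proof.
have sZ := generated_subgroup (range (@bold_ti p n)).
have part m : (m <= n)%N ->
    @Z_power p n (fun i => if (i < m)%N then bold_t p ^+ c i else 1).
  elim: m => [_|m IH lt_mn]; first by case: sZ.
  pose i0 := Ordinal lt_mn.
  suff -> : (fun i : 'I_n => if (i < m.+1)%N then bold_t p ^+ c i else 1) =
      ((fun i => if (i < m)%N then bold_t p ^+ c i else 1) : power n (padic p))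
      * bold_ti p i0 ^+ c i0.
    apply: (subgroupM sZ); first exact: IH (ltnW lt_mn).
    by apply: (subgroupX _ sZ); apply: sub_generated; exists i0.
  apply: functional_extensionality_dep => i.
  have -> (x y : power n (padic p)) : (x * y) i = x i * y i by [].
  have -> (x : power n (padic p)) k : (x ^+ k) i = x i ^+ k.
    by elim: k => [//|k IHk]; rewrite !expgS -IHk.
  rewrite /bold_ti ltnS leq_eqVlt -(inj_eq val_inj) /=.
  case: eqVneq => [eim|_] /=; last by rewrite expg1n mulg1.
  by rewrite eim ltnn mul1g; congr (_ ^+ c _); exact: val_inj.
have := part n (leqnn n); congr (@Z_power p n _).
by apply: functional_extensionality_dep => i; rewrite ltn_ord.
Qed.

(** Exponents of the generator of C_r found at a single level r already
    determine an integral framing, which agrees with the given element at that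
    level. *)
Lemma framed_braid_image_dense :
  dense (to_padic_framed_braid p n @` framed_braid p n).
Proof.
apply: dense_invlim => y r.
have /choice [c cP] : forall i, exists k, (val y r).1 i = t p r ^+ k.
  by move=> i; exact: t_generates.
pose x : padic_sdprod p n := (fun i => bold_t p ^+ c i, (val y r).2).
exists (to_padic_framed_braid p n x).
  by exists x => //; exact: Z_power_coord.
rewrite [RHS]surjective_pairing; congr (_, _).
apply: functional_extensionality_dep => i.
by rewrite cP; exact: (@valX (C_system p) (bold_t p) (c i) r).
Qed.

(** A framed braid factors as a framing times a braid. Braids are products of
    the sigma_j, and the generators of the integral framings are obtained from
    the first one by successive conjugation by the sigma_j. *)
Lemma framed_braid_generated (n_gt0 : (0 < n)%N) :
  framed_braid p n `<=` generated (framed_generators p (Ordinal n_gt0)).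
Proof.
set G := generated _.
have sG : subgroup G by exact: generated_subgroup.
pose compl := sd_complement (perm_act n (padic p)).
pose ker := @sd_kernel _ _ (perm_act n (padic p)).
have G_braid b : G (compl b).
  apply: (@braid_generated n (compl @^-1` G)
    (preimage_subgroup (sd_complementM _) sG)).
  by move=> _ [j _ <-]; apply: sub_generated; right; exists j.
have G_ti m (lt_mn : (m < n)%N) : G (ker (bold_ti p (Ordinal lt_mn))).
  elim: m lt_mn => [|m IH] lt_mn.
    rewrite (bool_irrelevance lt_mn n_gt0).
    by apply: sub_generated; left.
  have lt_mn1 : (m < n.-1)%N by rewrite -ltnS prednK.
  pose j := Ordinal lt_mn1.
  have -> : bold_ti p (Ordinal lt_mn) =
      perm_act n (padic p) (sigma j) (bold_ti p (strand j)).
    apply: functional_extensionality_dep => i.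
    rewrite /= /bold_ti braid_perm_sigma.
    congr (if _ then _ else _).
    (* [strand j] is the image of [next_strand j] under the transposition,
       which injectivity then cancels. *)
    rewrite -{2}(tpermR (strand j) (next_strand j)) (inj_eq perm_inj).
    by rewrite -!val_eqE.
  rewrite /ker -sd_conj.
  have -> : strand j = Ordinal (ltnW lt_mn) by exact: val_inj.
  apply: (subgroupM sG); last by apply: (subgroupV sG); exact: G_braid.
  by apply: (subgroupM sG); [exact: G_braid | exact: IH].
move=> z /= Zz; rewrite (sd_factor z).
apply: (subgroupM sG); last exact: G_braid.
apply: (@generated_min _ _ (ker @^-1` G)
  (preimage_subgroup (sd_kernelM _) sG)) Zz.
by move=> _ [[m lt_mn] _ <-]; exact: G_ti.
Qed.
End Padic.

Unset Implicit Arguments.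

Theorem theorem1 (p n : nat) (p_prime : prime p) (n_gt0 : (0 < n)%N) :
  [/\ group_iso (to_padic_framed_braid p n),
      group_iso (to_lim_sdprod p n),
      dense (framed_braid p n : set (power n (padic p) * braid n)%type),
      dense (to_padic_framed_braid p n @` framed_braid p n) &
      topological_generators
        (to_padic_framed_braid p n @` framed_generators p (Ordinal n_gt0))].
Proof.
have dF := @framed_braid_image_dense p n.
split; [exact: framed_to_framed_lim_iso | exact: framed_to_power_lim_iso |
        | exact: dF |].
- suff <- : @framed_of_framed_lim n (C_system p)
      @` (to_padic_framed_braid p n @` framed_braid p n) = framed_braid p n.
    apply: (dense_image (@framed_of_framed_lim_continuous n (C_system p))) dF.
    by move=> x; exists (to_padic_framed_braid p n x);
      exact: framed_to_framed_limK.
  rewrite image_comp -[RHS]image_id; apply: eq_imagel => x _.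
  exact: framed_to_framed_limK.
apply: denseS dF.
apply: subset_trans (image_generated (@framed_to_framed_limM n (C_system p))).
exact: image_subset (@framed_braid_generated p n n_gt0).
Qed.
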